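(* Let $S_\infty$ be the group of finitely supported permutations of $\mathbb{N}$ with the support norm $\|\sigma\|_{\mathrm{supp}}=|\{n\in\mathbb{N}:\sigma(n)\neq n\}|$, and let $\omega$ be a non-principal ultrafilter on $\mathbb{N}$. On the group $\mathrm{Cone}_\omega(S_\infty,\|\cdot\|_{\mathrm{supp}})$ the induced norm $\|[x_n]\|_{\mathrm{supp}}=\lim_\omega\|x_n\|_{\mathrm{supp}}/n$ is coarsely equivalent to every word norm on $\mathrm{Cone}_\omega(S_\infty,\|\cdot\|_{\mathrm{supp}})$ generated by finitely many conjugacy classes.
   Context: Asymptotic cone (scaling sequence $s_n=n$): a sequence $(x_n)_{n\ge1}$ in $S_\infty$ is admissible if $\|x_n\|_{\mathrm{supp}}/n$ is bounded; $\mathrm{Cone}_\omega(S_\infty,\|\cdot\|_{\mathrm{supp}})$ is the set of admissible sequences modulo $(x_n)\sim(y_n)$ iff $\lim_\omega\|x_ny_n^{-1}\|_{\mathrm{supp}}/n=0$. It is a group under termwise multiplication. A word norm generated by finitely many conjugacy classes on a group $C$ is $g\mapsto\min\{m\ge0\mid g=t_1\cdots t_m,\ t_i\in T\}$, where $T=T^{-1}$ is a generating set of $C$ which is a union of finitely many conjugacy classes of $C$. Two conjugation invariant norms $\|\cdot\|_1,\|\cdot\|_2$ on a group are coarsely equivalent if there are constants $A>0$, $B\ge0$ with $\frac1A\|\cdot\|_1-B\le\|\cdot\|_2\le A\|\cdot\|_1+B$. *)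

(* Defs.v *)
From HB Require Import structures.
From mathcomp Require Import all_boot all_order all_algebra finmap.
From mathcomp Require Import boolp classical_sets functions cardinality.
From mathcomp Require Import reals topology normedtype sequences.

Set Implicit Arguments.
Unset Strict Implicit.
Unset Printing Implicit Defensive.

Import Order.TTheory GRing.Theory Num.Theory.
Import numFieldNormedType.Exports.

Local Open Scope classical_set_scope.
Local Open Scope quotient_scope.
Local Open Scope ring_scope.

Section Groups.
Variable G : groupType.
Implicit Types (T : set G) (g : G).

Definition conj_class g : set G := range (fun h => (g ^ h)%g).

Definition generates T :=
  forall H : {pred G}, group_closed H -> {subset T <= H} ->
  forall g, g \in H.

Definition class_generating T :=
  [/\ T = [set (t^-1)%g | t in T],
      exists s : seq G, T = \bigcup_(c in [set` s]) conj_class c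
    & generates T].

Definition word_lengths T g : set nat :=
  [set m | exists s : seq G,
     [/\ size s = m, {subset s <= T} & g = (\prod_(t <- s) t)%g]].

(* The least element of [word_lengths T g]; the default value 0 is not used
   when T satisfies [class_generating], see [word_normP]. *)
Definition word_norm T g : nat :=
  xget 0%N [set m | word_lengths T g m /\
                    forall k, word_lengths T g k -> (m <= k)%N].

Definition coarsely_equivalent (R : realType) (N1 N2 : G -> R) :=
  exists A B : R, [/\ 0 < A, 0 <= B &
    forall g, A^-1 * N1 g - B <= N2 g <= A * N1 g + B].

Lemma word_lengths_neq0 T g : class_generating T -> word_lengths T g !=set0.
Proof.
move=> [TV _ Tgen].
pose H : {pred G} := fun x => `[< word_lengths T x !=set0 >].
have HP x : reflect (exists s : seq G, {subset s <= T} /\ x = (\prod_(t <- s) t)%g)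
    (x \in H).
  apply: (iffP (asboolP _)) => [[m [s [_ sT ->]]]|[s [sT ->]]].
    by exists s.
  by exists (size s), s.
apply/asboolP; apply: (Tgen H).
  split; first by apply/HP; exists [::]; rewrite big_nil.
  move=> x y /HP[s [sT ->]] /HP[r [rT ->]]; apply/HP.
  exists (s ++ rev [seq (t^-1)%g | t <- r]); split.
    move=> t; rewrite mem_cat mem_rev => /orP[/sT//|/mapP[u /rT uT ->]].
    by rewrite inE TV; exists u => //; rewrite inE in uT.
  rewrite big_cat; congr (_ * _)%g.
  elim: r {rT} => [|u r IHr]; first by rewrite !big_nil invg1.
  by rewrite /= rev_cons -cats1 big_cat big_seq1 big_cons invgM IHr.
move=> t tT; apply/HP; exists [:: t]; split; last by rewrite big_seq1.
by move=> u; rewrite inE => /eqP->.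
Qed.

Lemma word_normP T g : class_generating T ->
  word_lengths T g (word_norm T g) /\
  forall k, word_lengths T g k -> (word_norm T g <= k)%N.
Proof.
move=> /word_lengths_neq0-/(_ g) Tg.
apply: (@xgetPex _ 0%N
  [set m | word_lengths T g m /\ forall k, word_lengths T g k -> (m <= k)%N]).
have exP : exists m, `[< word_lengths T g m >].
  by have [m ?] := Tg; exists m; apply/asboolP.
case: (ex_minnP exP) => m /asboolP Pm minm; exists m; split=> // k Pk.
by apply: minm; apply/asboolP.
Qed.

End Groups.

(* S_infty, with the product (s * t) n = s (t n) *)
Record fsperm := FSPerm {
  fsperm_fun :> nat -> nat;
  fsperm_bij : bijective fsperm_fun;
  fsperm_fin : finite_set [set n | fsperm_fun n <> n] }.

HB.instance Definition _ := gen_eqMixin fsperm.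
HB.instance Definition _ := gen_choiceMixin fsperm.

Definition supp (s : fsperm) : set nat := [set n | s n <> n].

Definition supp_norm (s : fsperm) : nat := #|` fset_set (supp s)|.

Lemma fsperm_ext (s t : fsperm) : s =1 t -> s = t.
Proof.
case: s t => [f fb ff] [g gb gf] /= /funext fg.
by subst g; congr FSPerm; exact: Prop_irrelevance.
Qed.

Lemma fsperm_inj (s : fsperm) : injective s.
Proof. exact/bij_inj/fsperm_bij. Qed.

Section FSPermGroup.
Implicit Types s t : fsperm.

Lemma fsperm_one_fin : finite_set [set n : nat | id n <> n].
Proof. by rewrite (_ : mkset _ = set0) // -subset0 => n /=. Qed.

Definition fsperm_one := FSPerm (inv_bij (fun=> erefl)) fsperm_one_fin.

Lemma fsperm_mul_fin s t : finite_set [set n | (s \o t) n <> n].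
Proof.
apply: (@sub_finite_set _ _ (supp s `|` supp t)).
  move=> n /= stn; have [tn|tn] := pselect (t n = n); last by right.
  by left=> sn; apply: stn; rewrite tn.
by rewrite finite_setU; split; exact: fsperm_fin.
Qed.

Definition fsperm_mul s t :=
  FSPerm (bij_comp (fsperm_bij s) (fsperm_bij t)) (@fsperm_mul_fin s t).

Definition fsperm_inv_fun s (n : nat) : nat := xget 0%N [set m | s m = n].

Lemma fsperm_invK s : cancel (fsperm_inv_fun s) s.
Proof.
move=> n; apply: (@xgetPex _ 0%N [set m | s m = n]).
by have [g _ gK] := fsperm_bij s; exists (g n); exact: gK.
Qed.

Lemma fsperm_invKV s : cancel s (fsperm_inv_fun s).
Proof. by move=> n; apply: (@fsperm_inj s); rewrite fsperm_invK. Qed.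

Lemma fsperm_inv_fin s : finite_set [set n | fsperm_inv_fun s n <> n].
Proof.
apply: (@sub_finite_set _ _ (supp s)); last exact: fsperm_fin.
by move=> n /= sn sn'; apply: sn; rewrite -{1}sn' fsperm_invKV.
Qed.

Definition fsperm_inv s :=
  FSPerm (Bijective (fsperm_invK s) (fsperm_invKV s)) (@fsperm_inv_fin s).

Lemma fsperm_mulA : associative fsperm_mul.
Proof. by move=> s t u; exact: fsperm_ext. Qed.
Lemma fsperm_1mul : left_id fsperm_one fsperm_mul.
Proof. by move=> s; exact: fsperm_ext. Qed.
Lemma fsperm_mul1 : right_id fsperm_one fsperm_mul.
Proof. by move=> s; exact: fsperm_ext. Qed.
Lemma fsperm_mulV : left_inverse fsperm_one fsperm_inv fsperm_mul.
Proof. by move=> s; apply: fsperm_ext => n /=; exact: fsperm_invKV. Qed.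
Lemma fsperm_Vmul : right_inverse fsperm_one fsperm_inv fsperm_mul.
Proof. by move=> s; apply: fsperm_ext => n /=; exact: fsperm_invK. Qed.

HB.instance Definition _ := isGroup.Build fsperm
  fsperm_mulA fsperm_1mul fsperm_mul1 fsperm_mulV fsperm_Vmul.

Lemma fspermM s t n : (s * t)%g n = s (t n). Proof. by []. Qed.

Lemma supp_norm1 : supp_norm 1%g = 0%N.
Proof.
rewrite /supp_norm (_ : supp _ = set0) ?fset_set0 ?cardfs0//.
by rewrite -subset0 => n /=.
Qed.

Lemma supp_normV s : supp_norm s^-1%g = supp_norm s.
Proof.
rewrite /supp_norm; congr #|` fset_set _|.
apply/seteqP; split=> n /= sn sn'; apply: sn.
  by rewrite -{1}sn'; exact: fsperm_invKV.
by rewrite -{1}sn'; exact: fsperm_invK.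
Qed.

Lemma supp_normM s t : (supp_norm (s * t)%g <= supp_norm s + supp_norm t)%N.
Proof.
have fs := fsperm_fin s; have ft := fsperm_fin t.
apply: (@leq_trans #|` fset_set (supp s `|` supp t)|).
  apply/fsubset_leq_card; rewrite -fset_set_sub.
  - move=> n /= stn; have [tn|tn] := pselect (t n = n); last by right.
    by left=> sn; apply: stn; rewrite fspermM tn.
  - exact: fsperm_fin.
  - by rewrite finite_setU.
by rewrite fset_setU// cardfsU leq_subr.
Qed.

Lemma supp_normJ s t : supp_norm (s ^ t)%g = supp_norm s.
Proof.
have leJ (u v : fsperm) : (supp_norm (u ^ v)%g <= supp_norm u)%N.
  have vK n : v ((v^-1)%g n) = n by exact: fsperm_invK.
  rewrite /supp_norm.
  have -> : supp (u ^ v)%g = (v^-1)%g @` supp u.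
    apply/seteqP; split=> [n /= un|_ [n /= un <-]].
      exists (v n); last exact: fsperm_invKV.
      by move=> uvn; apply: un; rewrite /= uvn; exact: fsperm_invKV.
    rewrite /supp /= -[X in ~ X]/((v^-1)%g (u (v ((v^-1)%g n))) = (v^-1)%g n) vK.
    by move=> /(@fsperm_inj v^-1%g).
  rewrite fset_set_image ?card_imfset//=; last exact: fsperm_fin.
  exact: (@fsperm_inj v^-1%g).
by apply/eqP; rewrite eqn_leq leJ -{1}(conjgK t s) leJ.
Qed.

End FSPermGroup.

Section Cone.
Variable R : realType.

(* Sequences are indexed by all of nat; their value at 0 is irrelevant: 0 is
   excluded here, and it is negligible for a non-principal ultrafilter. *)
Definition admissible (x : nat -> fsperm) :=
  exists K : R, forall n, (0 < n)%N -> (supp_norm (x n))%:R / n%:R <= K.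

Record adm_seq := AdmSeq {
  adm_fun :> nat -> fsperm;
  admP : admissible adm_fun }.

HB.instance Definition _ := gen_eqMixin adm_seq.
HB.instance Definition _ := gen_choiceMixin adm_seq.

Implicit Types x y : adm_seq.

Lemma adm_ext x y : x =1 y -> x = y.
Proof.
case: x y => [f fb] [g gb] /= /funext fg.
by subst g; congr AdmSeq; exact: Prop_irrelevance.
Qed.

Definition scaled_norm (u : nat -> fsperm) (n : nat) : R :=
  (supp_norm (u n))%:R / n%:R.

Lemma scaled_norm_ge0 u n : 0 <= scaled_norm u n.
Proof. by rewrite divr_ge0. Qed.

Lemma scaled_normM (u v : nat -> fsperm) n :
  scaled_norm (fun k => u k * v k)%g n <= scaled_norm u n + scaled_norm v n.
Proof.
rewrite -mulrDl ler_wpM2r ?invr_ge0// -natrD ler_nat.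
exact: supp_normM.
Qed.

Lemma scaled_normV (u : nat -> fsperm) n :
  scaled_norm (fun k => (u k)^-1)%g n = scaled_norm u n.
Proof. by rewrite /scaled_norm supp_normV. Qed.

Lemma adm_one_subproof : admissible (fun=> 1%g).
Proof. by exists 0 => n _; rewrite supp_norm1 mul0r. Qed.

Lemma adm_mul_subproof x y : admissible (fun n => x n * y n)%g.
Proof.
have [K xK] := admP x; have [L yL] := admP y; exists (K + L) => n n0.
exact: le_trans (scaled_normM x y n) (lerD (xK n n0) (yL n n0)).
Qed.

Lemma adm_inv_subproof x : admissible (fun n => (x n)^-1)%g.
Proof. by have [K xK] := admP x; exists K => n n0; rewrite supp_normV xK. Qed.

Definition adm_one := AdmSeq adm_one_subproof.
Definition adm_mul x y := AdmSeq (adm_mul_subproof x y).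
Definition adm_inv x := AdmSeq (adm_inv_subproof x).

Lemma adm_mulA : associative adm_mul.
Proof. by move=> x y z; apply: adm_ext => n; exact: mulgA. Qed.
Lemma adm_1mul : left_id adm_one adm_mul.
Proof. by move=> x; apply: adm_ext => n; exact: mul1g. Qed.
Lemma adm_mul1 : right_id adm_one adm_mul.
Proof. by move=> x; apply: adm_ext => n; exact: mulg1. Qed.
Lemma adm_mulV : left_inverse adm_one adm_inv adm_mul.
Proof. by move=> x; apply: adm_ext => n; exact: mulVg. Qed.
Lemma adm_Vmul : right_inverse adm_one adm_inv adm_mul.
Proof. by move=> x; apply: adm_ext => n; exact: mulgV. Qed.

HB.instance Definition _ := isGroup.Build adm_seq
  adm_mulA adm_1mul adm_mul1 adm_mulV adm_Vmul.

Variables (w : set_system nat) (Uw : UltraFilter w).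

Definition cone_rel : rel adm_seq := fun x y =>
  `[< scaled_norm (fun n => x n / y n)%g @ w --> (0 : R) >].

Lemma cone_relP x y :
  reflect (scaled_norm (x / y)%g @ w --> (0 : R)) (cone_rel x y).
Proof. exact: asboolP. Qed.

Lemma scaled_norm_squeeze0 (u v : nat -> fsperm) :
  (forall n, scaled_norm u n <= scaled_norm v n) ->
  scaled_norm v @ w --> (0 : R) -> scaled_norm u @ w --> (0 : R).
Proof.
move=> uv v0; apply: (@squeeze_cvgr nat w _ R (cst 0) (scaled_norm v)) => //.
  by apply: nearW => n; rewrite scaled_norm_ge0 uv.
exact: cvg_cst.
Qed.

Lemma scaled_normM_cvg0 (u v : nat -> fsperm) :
  scaled_norm u @ w --> (0 : R) -> scaled_norm v @ w --> (0 : R) ->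
  scaled_norm (fun n => u n * v n)%g @ w --> (0 : R).
Proof.
move=> u0 v0; have uv0 := cvgD u0 v0; rewrite addr0 in uv0.
apply: (@squeeze_cvgr nat w _ R (cst 0)
  (fun n => scaled_norm u n + scaled_norm v n)).
- by apply: nearW => n; rewrite scaled_norm_ge0 scaled_normM.
- exact: cvg_cst.
- exact: uv0.
Qed.

Lemma cone_rel_refl : reflexive cone_rel.
Proof.
move=> x; apply/cone_relP; rewrite mulgV.
rewrite (_ : scaled_norm _ = cst 0); first exact: cvg_cst.
by apply/funext => n; rewrite /scaled_norm supp_norm1 mul0r.
Qed.

Lemma cone_rel_impl x y : cone_rel x y -> cone_rel y x.
Proof.
move=> /cone_relP xy; apply/cone_relP; apply: scaled_norm_squeeze0 xy => n.
rewrite -scaled_normV (_ : (fun k => _) = (x / y)%g :> (nat -> fsperm))//.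
by apply/funext => k; rewrite -[LHS]/((y k / x k)^-1)%g invgF.
Qed.

Lemma cone_rel_sym : symmetric cone_rel.
Proof. by move=> x y; apply/idP/idP; exact: cone_rel_impl. Qed.

Lemma cone_rel_trans : transitive cone_rel.
Proof.
move=> y x z /cone_relP xy /cone_relP yz; apply/cone_relP.
have := scaled_normM_cvg0 xy yz.
rewrite (_ : (fun k => _) = (x / z)%g :> (nat -> fsperm))//.
by apply/funext => k; rewrite -[LHS]/(x k / y k * (y k / z k))%g mulgA mulgVK.
Qed.

Canonical cone_equiv := EquivRel cone_rel cone_rel_refl cone_rel_sym
  cone_rel_trans.

Lemma cone_rel_mul x x' y y' :
  cone_rel x x' -> cone_rel y y' -> cone_rel (x * y)%g (x' * y')%g.
Proof.
move=> /cone_relP xx' /cone_relP yy'; apply/cone_relP.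
have yy'J : scaled_norm (fun n => (y n / y' n) ^ (x n)^-1)%g @ w --> (0 : R).
  by apply: scaled_norm_squeeze0 yy' => n; rewrite /scaled_norm supp_normJ.
have := scaled_normM_cvg0 yy'J xx'.
rewrite (_ : (fun k => _) = (x * y / (x' * y'))%g :> (nat -> fsperm))//.
apply/funext => k.
rewrite -[LHS]/((y k / y' k) ^ (x k)^-1 * (x k / x' k))%g.
rewrite -[RHS]/(x k * y k / (x' k * y' k))%g conjgE invgK invgM.
by rewrite !mulgA mulgVK.
Qed.

Lemma cone_rel_inv x y : cone_rel x y -> cone_rel x^-1%g y^-1%g.
Proof.
move=> /cone_rel_impl/cone_relP yx; apply/cone_relP.
apply: scaled_norm_squeeze0 yx => n.
rewrite /scaled_norm -(supp_normJ ((y / x)%g n) (y n)).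
rewrite (_ : _ ^ _ = (x^-1 / y^-1)%g n)%g//.
rewrite -[LHS]/((y n / x n) ^ y n)%g -[RHS]/((x n)^-1 / (y n)^-1)%g.
by rewrite conjgE invgK !mulgA mulVg mul1g.
Qed.

Definition cone := {eq_quot cone_rel}.

HB.instance Definition _ := Choice.on cone.
HB.instance Definition _ := EqQuotient.on cone.

Lemma cone_eqP x y : reflect (\pi_cone x = \pi_cone y) (cone_rel x y).
Proof. by apply: (iffP idP) => /eqmodP. Qed.

Definition cone_one : cone := \pi_cone 1%g.
Definition cone_mul (a b : cone) : cone := \pi_cone (repr a * repr b)%g.
Definition cone_inv (a : cone) : cone := \pi_cone (repr a)^-1%g.

Lemma cone_pi_mul x y :
  cone_mul (\pi_cone x) (\pi_cone y) = \pi_cone (x * y)%g.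
Proof. by apply/cone_eqP/cone_rel_mul; apply/cone_eqP; rewrite reprK. Qed.

Lemma cone_pi_inv x : cone_inv (\pi_cone x) = \pi_cone x^-1%g.
Proof. by apply/cone_eqP/cone_rel_inv; apply/cone_eqP; rewrite reprK. Qed.

Lemma cone_mulA : associative cone_mul.
Proof.
move=> a b c; elim/(@quotW _ cone): a => x; elim/(@quotW _ cone): b => y.
elim/(@quotW _ cone): c => z.
by rewrite !cone_pi_mul mulgA.
Qed.
Lemma cone_1mul : left_id cone_one cone_mul.
Proof. by move=> a; elim/(@quotW _ cone): a => x; rewrite cone_pi_mul mul1g. Qed.
Lemma cone_mul1 : right_id cone_one cone_mul.
Proof. by move=> a; elim/(@quotW _ cone): a => x; rewrite cone_pi_mul mulg1. Qed.
Lemma cone_mulV : left_inverse cone_one cone_inv cone_mul.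
Proof.
by move=> a; elim/(@quotW _ cone): a => x;
  rewrite cone_pi_inv cone_pi_mul mulVg. Qed.
Lemma cone_Vmul : right_inverse cone_one cone_inv cone_mul.
Proof.
by move=> a; elim/(@quotW _ cone): a => x;
  rewrite cone_pi_inv cone_pi_mul mulgV. Qed.

HB.instance Definition _ := isGroup.Build cone
  cone_mulA cone_1mul cone_mul1 cone_mulV cone_Vmul.

Lemma cone_piM x y : \pi_cone (x * y)%g = (\pi_cone x * \pi_cone y)%g.
Proof. by rewrite -cone_pi_mul. Qed.

Lemma cone_piV x : \pi_cone x^-1%g = (\pi_cone x)^-1%g.
Proof. by rewrite -cone_pi_inv. Qed.

(* The limit exists and does not depend on the representative [repr a]: see
   [cone_norm_cvg]. *)
Definition cone_norm (a : cone) : R := lim (scaled_norm (repr a) @ w).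

Lemma scaled_norm_cvg x : cvg (scaled_norm x @ w).
Proof.
have [K xK] := admP x.
have wx : (scaled_norm x @ w) `[0, Num.max 0 K]%classic.
  apply: (@nearW _ w) => n; rewrite /= in_itv /= scaled_norm_ge0 /= le_max.
  have [->|n0] := posnP n; first by rewrite /scaled_norm invr0 mulr0 lexx.
  by rewrite (xK _ n0) orbT.
have [l [_ clust]] := @segment_compact R _ _ _ (fmap_proper_filter _ _) wx.
apply/cvg_ex; exists l => U lU.
have [//|wU] := @in_ultra_setVsetC _ w (scaled_norm x @^-1` U) Uw.
by have [r [/= nUr Ur]] := clust (~` U) U wU lU.
Qed.

Lemma cone_norm_cvg x : scaled_norm x @ w --> cone_norm (\pi_cone x).
Proof.
set y := repr (\pi_cone x).
have /cone_relP yx : cone_rel y x by apply/cone_eqP; rewrite reprK.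
have /cone_relP xy : cone_rel x y by apply/cone_eqP; rewrite reprK.
have leD (u v : adm_seq) n : scaled_norm u n <= scaled_norm (u / v)%g n + scaled_norm v n.
  apply: le_trans (scaled_normM (u / v)%g v n).
  by rewrite /scaled_norm -[X in _ <= (supp_norm X)%:R / _]/(u n / v n * v n)%g mulgVK.
have cy : scaled_norm y @ w --> cone_norm (\pi_cone x).
  exact: scaled_norm_cvg.
have l1 := cvgB cy yx; have l2 := cvgD xy cy.
rewrite subr0 in l1; rewrite add0r in l2.
apply: (@squeeze_cvgr nat w _ R (fun n => scaled_norm y n - scaled_norm (y / x)%g n)
  (fun n => scaled_norm (x / y)%g n + scaled_norm y n)).
- by apply: nearW => n; rewrite lerBlDl !leD.
- exact: l1.
- exact: l2.
Qed.

Lemma cone_norm_pi x : cone_norm (\pi_cone x) = lim (scaled_norm x @ w).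
Proof. exact/esym/cvg_lim/cone_norm_cvg. Qed.

End Cone.

(* Main.v *)
Require Import Defs.
From mathcomp Require Import all_boot all_order all_algebra finmap.
From mathcomp Require Import zify lra.
From mathcomp Require Import boolp classical_sets functions cardinality.
From mathcomp Require Import filter reals topology normedtype.

(* The word norm dominates the support norm because the latter is conjugation
   invariant, subadditive, and bounded on finitely many conjugacy classes.

   Conversely, let [t = [x_n]] be a generator of norm [d > 0]. If [A] is a set
   of about [|supp x_n| / 3] points with [A] disjoint from [x_n A], then for any
   involution [u] supported on [A], the commutator of [u] and [x_n] is the
   product of [u] and a disjoint copy of it, and also the product of two
   conjugates of [x_n] and [x_n^-1]. So every involution with at most
   [|supp x_n| / 3] transpositions is, up to one transposition (which the cone
   does not see), a product of two such conjugates, whose conjugators have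
   support of size O(n) and thus define elements of the cone. Now any finitary
   permutation is a product of two involutions, and an involution splits into
   involutions with few transpositions; hence an element of norm [r] has word
   norm O(r / d + 1). *)

Set Implicit Arguments.
Unset Strict Implicit.
Unset Printing Implicit Defensive.

Import Order.TTheory GRing.Theory Num.Theory numFieldNormedType.Exports.

Local Open Scope classical_set_scope.
Local Open Scope ring_scope.

(** * Supports of finitary permutations, and transpositions *)

Section FinitaryPermutations.
Local Open Scope nat_scope.
Implicit Types (s t x : fsperm) (l : seq nat) (P Q : seq (nat * nat)).

Lemma mem_supp_seq s n : (n \in fset_set (supp s)) = (s n != n).
Proof.
rewrite in_fset_set; last exact: fsperm_fin.
by apply/idP/idP => [/set_mem/eqP|/eqP ns]//; exact/mem_set.
Qed.

Lemma supp_norm_le_size s l :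
  (forall n, s n != n -> n \in l) -> supp_norm s <= size l.
Proof.
move=> sl; apply: leq_trans (size_undup l); apply: uniq_leq_size.
  exact: fset_uniq.
by move=> n ns; rewrite mem_undup sl// -mem_supp_seq.
Qed.

Lemma supp_norm_gt_size s l :
  size l < supp_norm s -> exists2 n, s n != n & n \notin l.
Proof.
move=> ls; apply: contrapT => nex; move: ls; apply/negP; rewrite -leqNgt.
apply: supp_norm_le_size => n sn; apply: contrapT => /negP nl.
by apply: nex; exists n.
Qed.

Definition swap (a b n : nat) : nat :=
  if n == a then b else if n == b then a else n.

Lemma swapK a b : involutive (swap a b).
Proof.
move=> n; rewrite /swap.
have [->|na] := eqVneq n a; first by case: (eqVneq b a) => [->|_] //; rewrite eqxx.
have [->|nb] := eqVneq n b; first by rewrite eqxx.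
by rewrite (negPf na) (negPf nb).
Qed.

Lemma swap_fin a b : finite_set [set n | swap a b n <> n]%classic.
Proof.
apply: (@sub_finite_set _ _ [set` [:: a; b]]) => [n /=|]; last first.
  exact: finite_seq.
rewrite /swap !inE; case: eqVneq => // na; case: eqVneq => // nb.
Qed.

Definition transp a b := FSPerm (inv_bij (@swapK a b)) (@swap_fin a b).

Lemma transpV a b : (transp a b)^-1%g = transp a b.
Proof.
apply: (mulgI (transp a b)); rewrite mulgV; apply: fsperm_ext => n.
by rewrite fspermM /= swapK.
Qed.

Lemma transpL a b : transp a b a = b.
Proof. by rewrite /= /swap eqxx. Qed.

Lemma transpR a b : transp a b b = a.
Proof. by rewrite /= /swap; case: eqVneq => [->|]; rewrite ?eqxx. Qed.

Lemma transpD a b n : n != a -> n != b -> transp a b n = n.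
Proof. by rewrite /= /swap => /negPf-> /negPf->. Qed.

Lemma supp_norm_transp a b : supp_norm (transp a b) <= 2.
Proof.
apply: (@supp_norm_le_size _ [:: a; b]) => n; rewrite !inE.
by apply: contraR; rewrite negb_or => /andP[na nb]; rewrite transpD.
Qed.

Lemma fsperm_applyVK s n : s (s^-1%g n) = n.
Proof. exact: fsperm_invK. Qed.

Lemma fsperm_applyKV s n : s^-1%g (s n) = n.
Proof. exact: fsperm_invKV. Qed.

Lemma transp_conj s a b : transp (s a) (s b) = (transp a b ^ s^-1)%g.
Proof.
apply: fsperm_ext => n; rewrite conjgE invgK !fspermM.
rewrite -{1}(fsperm_applyVK s n); move: (s^-1%g n) => m.
by rewrite /= /swap !(inj_eq (@fsperm_inj s)); case: eqP => // _; case: eqP.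
Qed.

(** * Products of transpositions, given by lists of pairs *)

Definition tprod P : fsperm := (\prod_(p <- P) transp p.1 p.2)%g.

(** [uniq (flat P)] says that the transpositions in [P] are nontrivial and pairwise disjoint, so
    that [tprod P] is an involution. *)
Definition flat P : seq nat := flatten [seq [:: p.1; p.2] | p <- P].

Definition map_pair (f : nat -> nat) P := [seq (f p.1, f p.2) | p <- P].

Lemma tprod_cat P Q : tprod (P ++ Q) = (tprod P * tprod Q)%g.
Proof. by rewrite /tprod big_cat. Qed.

Lemma tprodV P : (tprod P)^-1%g = tprod (rev P).
Proof.
elim: P => [|p P IH]; first by rewrite /tprod big_nil invg1.
rewrite rev_cons -cats1 tprod_cat -IH /tprod big_cons big_seq1 invgM.
by rewrite transpV.
Qed.

Lemma tprod_map s P : tprod (map_pair s P) = (tprod P ^ s^-1)%g.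
Proof.
elim: P => [|p P IH]; first by rewrite /tprod !big_nil conj1g.
by move: IH; rewrite /tprod /= !big_cons conjMg => ->; rewrite transp_conj.
Qed.

Lemma supp_norm_tprod P : supp_norm (tprod P) <= 2 * size P.
Proof.
elim: P => [|p P IH]; first by rewrite /tprod big_nil supp_norm1.
rewrite /tprod big_cons; apply: leq_trans (supp_normM _ _) _.
by have := supp_norm_transp p.1 p.2; move: IH; rewrite /tprod /=; lia.
Qed.

Lemma flat_cat P Q : flat (P ++ Q) = flat P ++ flat Q.
Proof. by rewrite /flat map_cat flatten_cat. Qed.

Lemma flat_map s P : flat (map_pair s P) = map s (flat P).
Proof. by elim: P => //= p P <-. Qed.

Lemma size_flat P : size (flat P) = 2 * size P.
Proof. by elim: P => //= p P; rewrite -/(flat P); lia. Qed.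

Lemma flat_inj : injective flat.
Proof.
elim=> [|[a b] P IH] [|[c d] Q] //=; rewrite -/(flat _) -/(flat Q).
by move=> [-> -> /IH->].
Qed.

Lemma perm_flat P Q : perm_eq P Q -> perm_eq (flat P) (flat Q).
Proof. by move=> PQ; apply/perm_flatten/perm_map. Qed.

Lemma flat_surj j l : size l = 2 * j -> exists P, flat P = l.
Proof.
elim: j l => [|j IH] [|a [|b l]] //=; try by [exists [::] | lia].
move=> sl; have [|P Pl] := IH l; first by lia.
by exists ((a, b) :: P); rewrite -Pl.
Qed.

(** * Disjoint transpositions as products of two conjugates *)

Lemma extend_injection l l' : uniq l -> uniq l' -> size l = size l' ->
  exists s, map s l = l' /\ supp_norm s <= 2 * size l.
Proof.
elim: l l' => [|a l IH] [|b l'] //=.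
  by move=> _ _ _; exists 1%g; rewrite supp_norm1.
move=> /andP[al ul] /andP[bl' ul'] [sll'].
have [s [sl sn]] := IH _ ul ul' sll'.
(* Neither [s a] nor [b] lies in [map s l = l'], so the new transposition leaves the points already
   placed where they are. *)
exists (transp (s a) b * s)%g; split.
  rewrite fspermM transpL -sl; congr cons; apply/eq_in_map => n nl.
  rewrite fspermM transpD// ?(inj_eq (@fsperm_inj s)).
    by apply: contraNneq al => <-.
  by apply: contraNneq bl' => <-; rewrite -sl map_f.
apply: leq_trans (supp_normM _ _) _.
by have := supp_norm_transp (s a) b; lia.
Qed.

(* Greedy choice: a new point has to avoid [l], [x l] and [x^-1 l]. *)
Lemma displaced_seq x k : 3 * k <= supp_norm x ->
  exists l, size l = k /\ uniq (l ++ map x l).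
Proof.
elim: k => [|k IH] kx; first by exists [::].
have [|l [sl ul]] := IH; first by lia.
have [|z xz] := @supp_norm_gt_size x (l ++ map x l ++ map x^-1%g l).
  by rewrite !size_cat !size_map; lia.
rewrite !mem_cat !negb_or => /and3P[zl zxl zVl].
exists (z :: l); rewrite /= sl; split=> //.
move: ul; rewrite !cat_uniq /= => /and3P[-> /hasPn h ->].
rewrite mem_cat inE !negb_or eq_sym zl xz zxl /= andbT.
rewrite (mem_map (@fsperm_inj x)) zl andbT.
apply/andP; split.
  by apply: contra zVl => xzl; rewrite -(fsperm_applyKV x z) map_f.
apply/hasPn => y yl; apply: h; exact: yl.
Qed.

Lemma commutator_tprod x j : 6 * j <= supp_norm x ->
  exists P h, [/\ size P = 2 * j, uniq (flat P), supp_norm h <= 2 * j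
    & tprod P = (x ^ h * x^-1)%g].
Proof.
move=> jx; have [|l [sl ul]] := @displaced_seq x (2 * j); first by lia.
have [P Pl] := flat_surj sl.
have sP : size P = j by have := size_flat P; rewrite Pl; lia.
(* Put [u = tprod P], a product of [j] transpositions of displaced points. Reversing the list gives
   [u^-1], so the two halves multiply to [u (x u^-1 x^-1)]. Regrouped as [(u x u^-1) x^-1], this is
   [x ^ h * x^-1] for [h = u^-1]. *)
exists (P ++ map_pair x (rev P)), (tprod P)^-1%g; split.
- by rewrite size_cat size_map size_rev; lia.
- rewrite flat_cat flat_map Pl (perm_uniq (_ : perm_eq _ (l ++ map x l)))//.
  by rewrite perm_cat2l perm_map// -Pl perm_flat// perm_rev.
- by rewrite supp_normV (leq_trans (supp_norm_tprod P))// sP.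
by rewrite tprod_cat tprod_map -tprodV !conjgE !invgK !mulgA.
Qed.

Lemma tprod_two_conj x P : uniq (flat P) ->
    size P <= 2 * (supp_norm x %/ 6) ->
  (* The commutator has an even number of transpositions; when [size P] is odd, the last
     transposition of [P] becomes [e]. *)
  exists h k e, [/\ supp_norm h <= 4 * supp_norm x,
    supp_norm k <= 4 * supp_norm x, supp_norm e <= 2
    & tprod P = (x ^ h * x^-1 ^ k * e)%g].
Proof.
move=> uP sP; set j := (size P)./2.
have jP : 2 * j <= size P /\ size P <= (2 * j).+1.
  by rewrite /j; have := odd_double_half (size P); case: odd; lia.
have jx : 6 * j <= supp_norm x.
  by have := leq_divM (supp_norm x) 6; lia.
have [Q [h [sQ uQ hn QE]]] := commutator_tprod jx.
have sT : size (take (2 * j) P) = 2 * j by rewrite size_takel; lia.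
have uT : uniq (flat (take (2 * j) P)).
  by move: uP; rewrite -{1}(cat_take_drop (2 * j) P) flat_cat cat_uniq => /andP[].
(* Both lists consist of [2 * j] disjoint pairs, so some [k] of small support carries [Q] onto the
   even part of [P] and conjugates one product into the other. *)
have [|k [kE kn]] := extend_injection uQ uT; first by rewrite !size_flat sT sQ.
exists (h * k^-1)%g, k^-1%g, (tprod (drop (2 * j) P)); split.
- apply: leq_trans (supp_normM _ _) _; rewrite supp_normV.
  by move: kn; rewrite size_flat; lia.
- by rewrite supp_normV; move: kn; rewrite size_flat; lia.
- by apply: leq_trans (supp_norm_tprod _) _; rewrite size_drop; lia.
rewrite -{1}(cat_take_drop (2 * j) P) tprod_cat; congr (_ * _)%g.
rewrite -flat_map in kE; have <- := flat_inj kE.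
by rewrite tprod_map QE conjMg conjgM.
Qed.

(** * Finitary permutations as products of two involutions *)

Lemma involution_tprod s l : involutive s ->
    (forall n, s n != n -> n \in l) ->
  exists P, [/\ uniq (flat P), size P <= size l, s = tprod P
    & {in flat P, forall n, s n != n}].
Proof.
elim: l s => [|a l IH] s sK sl.
  exists [::]; split=> //; rewrite /tprod big_nil; apply: fsperm_ext => n.
  by apply/eqP; apply: contraT => /sl.
have [sa|sa] := eqVneq (s a) a.
  have [//||P [uP sP PE Ps]] := IH s.
    move=> n sn; have := sl n sn; rewrite inE => /predU1P[na|//].
    by rewrite na sa eqxx in sn.
  by exists P; split=> //=; exact: leqW.
(* Removing the 2-cycle of [a] leaves an involution fixing [a] and [s a]. Since the pairs found for
   [t] consist of points moved by [t], they avoid these two. *)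
set t := (transp a (s a) * s)%g.
have ta : t a = a by rewrite fspermM transpR.
have tsa : t (s a) = s a by rewrite fspermM sK transpL.
have tE n : n != a -> n != s a -> t n = s n.
  move=> na nsa; rewrite fspermM transpD// ?(inj_eq (@fsperm_inj s))//.
  by apply: contraNneq nsa => <-; rewrite sK.
have tn n : t n != n -> [/\ n != a, n != s a & s n != n].
  move=> tn; have na : n != a by apply: contraNneq tn => ->; rewrite ta.
  have nsa : n != s a by apply: contraNneq tn => ->; rewrite tsa.
  by split=> //; rewrite -tE.
have tK : involutive t.
  move=> n; have [->|na] := eqVneq n a; first by rewrite !ta.
  have [->|nsa] := eqVneq n (s a); first by rewrite !tsa.
  rewrite (tE n)// tE ?sK// ?(inj_eq (@fsperm_inj s))//.
  by apply: contraNneq nsa => <-; rewrite sK.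
have [//||P [uP sP PE Pt]] := IH t.
  by move=> n /tn[na _ /sl]; rewrite inE (negPf na).
exists ((a, s a) :: P); split=> //=.
- rewrite -/(flat P) uP andbT inE negb_or eq_sym sa /=; apply/andP; split.
    by apply/negP => /Pt /tn[]; rewrite eqxx.
  by apply/negP => /Pt /tn[_]; rewrite eqxx.
- rewrite /tprod big_cons -/(tprod P) -PE /t mulgA -{1}(transpV a (s a)).
  by rewrite mulVg mul1g.
- move=> n; rewrite -/(flat P) !inE => /or3P[/eqP->//|/eqP->|/Pt/tn[]//].
  by rewrite (inj_eq (@fsperm_inj s)).
Qed.

(** Forward iterates on both sides encode an integer power: [n = s^(i-j) m]. *)
Definition same_orbit s m n := exists i j, iter i s m = iter j s n.

Lemma iter_fsperm_inj s i : injective (iter i s).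
Proof. by elim: i => [|i IH] m n //= /fsperm_inj/IH. Qed.

Lemma same_orbit_trans s m n p :
  same_orbit s m n -> same_orbit s n p -> same_orbit s m p.
Proof.
move=> [i [j mn]] [k [l np]]; exists (k + i), (j + l).
by rewrite iterD mn -iterD addnC iterD np -iterD.
Qed.

Lemma same_orbit_sym s m n : same_orbit s m n -> same_orbit s n m.
Proof. by move=> [i [j mn]]; exists j, i. Qed.

Definition orbit_base s m : nat := xget 0 [set r | same_orbit s m r]%classic.

Lemma orbit_baseP s m : same_orbit s m (orbit_base s m).
Proof.
by apply: (@xgetPex _ 0 [set r | same_orbit s m r]%classic); exists m, 0, 0.
Qed.

(** Points of one orbit define the same set of candidates, and [xget] depends only on that set. *)
Lemma orbit_base_eq s m n :
  same_orbit s m n -> orbit_base s m = orbit_base s n.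
Proof.
move=> mn; rewrite /orbit_base; congr xget; apply/seteqP; split=> r /=.
  exact/same_orbit_trans/same_orbit_sym.
exact: same_orbit_trans.
Qed.

(* With [r] the base point of the orbit, [m = s^d r] and [n = s^-d r]: the
   reflection of the orbit fixing [r]. *)
Definition reflected s m n := exists i j,
  iter i s m = iter j s (orbit_base s m) /\
  iter j s n = iter i s (orbit_base s m).

Lemma reflected_ex s m : exists n, reflected s m n.
Proof.
have [i [j mr]] := orbit_baseP s m.
exists (iter j s^-1%g (iter i s (orbit_base s m))), i, j; split=> //.
move: (iter i _ (orbit_base _ _)) => n; elim: j n {mr} => // j IH n.
by rewrite iterSr iterS fsperm_applyVK IH.
Qed.

(** On a finite orbit [d] is determined only modulo the length of the orbit. The image is still
    unique, since [s^(j+l)] sends both [n] and [p] to [s^(i+k) m]. *)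
Lemma reflected_inj s m n p : reflected s m n -> reflected s m p -> n = p.
Proof.
move=> [i [j [mr nr]]] [k [l [mr' pr]]]; apply: (@iter_fsperm_inj s (j + l)).
rewrite [RHS]iterD pr -iterD [j + k]addnC [RHS]iterD -mr -iterD.
by rewrite [j + l]addnC iterD nr -iterD [l + i]addnC iterD -mr' -iterD addnC.
Qed.

Lemma reflected_sym s m n : reflected s m n -> reflected s n m.
Proof.
move=> [i [j [mr nr]]]; exists j, i.
suff -> : orbit_base s n = orbit_base s m by [].
apply: orbit_base_eq; apply: (@same_orbit_trans _ _ (orbit_base s m)).
  by exists j, i.
by apply: same_orbit_sym; exists i, j.
Qed.

(** One step of [s] raises [d] by one, so the mirror image takes one step back. For the reflection
    [r] this says [r s = s^-1 r], which makes [r s] an involution. *)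
Lemma reflected_step s m n : reflected s m n -> reflected s (s m) (s^-1%g n).
Proof.
move=> [i [j [mr nr]]]; rewrite /reflected.
have <- : orbit_base s m = orbit_base s (s m).
  by apply: orbit_base_eq; exists 1, 0.
exists i, j.+1; rewrite -iterSr !iterS mr; split=> //.
by rewrite -iterS iterSr fsperm_applyVK.
Qed.

(** This confines the support of the reflection to that of [s]. *)
Lemma reflected_fixed s m : s m = m -> reflected s m m.
Proof.
move=> sm; have sim i : iter i s m = m by elim: i => //= i ->.
have [i [j mr]] := orbit_baseP s m; exists i, j; split=> //.
have <- : m = orbit_base s m.
  by apply: (@iter_fsperm_inj s j); rewrite -mr !sim.
by rewrite !sim.
Qed.

Definition reflection_fun s m : nat := xget 0 (reflected s m).

Lemma reflection_funP s m : reflected s m (reflection_fun s m).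
Proof. exact: (@xgetPex _ 0 (reflected s m)) (reflected_ex s m). Qed.

Lemma reflection_funE s m n : reflected s m n -> reflection_fun s m = n.
Proof. exact/reflected_inj/reflection_funP. Qed.

Lemma reflection_funK s : involutive (reflection_fun s).
Proof. by move=> m; apply/reflection_funE/reflected_sym/reflection_funP. Qed.

Lemma reflection_fin s : finite_set [set m | reflection_fun s m <> m]%classic.
Proof.
apply: (@sub_finite_set _ _ (supp s)) (@fsperm_fin s) => m /= rm sm.
exact/rm/reflection_funE/reflected_fixed.
Qed.

Definition reflection s :=
  FSPerm (inv_bij (@reflection_funK s)) (@reflection_fin s).

Lemma reflection_mulK s : involutive (reflection s * s)%g.
Proof.
move=> m; apply: (@fsperm_inj (reflection s)); rewrite !fspermM /=.
rewrite reflection_funK -[in RHS](fsperm_applyVK s (reflection_fun s m)).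
congr (s _); apply: reflection_funE.
exact/reflected_step/reflection_funP.
Qed.

(** With [r] the reflection, [s = r (r s)], and both factors are involutions supported in the
    support of [s]. *)
Lemma two_involutions_tprod s : exists P Q,
  [/\ uniq (flat P), uniq (flat Q), size P <= supp_norm s,
      size Q <= supp_norm s & s = (tprod P * tprod Q)%g].
Proof.
have rs m : reflection s m != m -> s m != m.
  by apply: contra => /eqP/reflected_fixed/reflection_funE/eqP.
have [||P [uP sP PE _]] := @involution_tprod (reflection s) (fset_set (supp s)).
- exact: reflection_funK.
- by move=> m /rs; rewrite mem_supp_seq.
have [||Q [uQ sQ QE _]] := @involution_tprod (reflection s * s)%g (fset_set (supp s)).
- exact: reflection_mulK.
- move=> m; rewrite mem_supp_seq; apply: contra => /eqP sm.
  by rewrite fspermM sm; apply: contraT => /rs; rewrite sm eqxx.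
exists P, Q; split=> //; rewrite -PE -QE mulgA.
rewrite (_ : reflection s * reflection s = 1)%g ?mul1g//.
by apply: fsperm_ext => m; rewrite fspermM; exact: reflection_funK.
Qed.

End FinitaryPermutations.

(** * Word lengths in an abstract group *)

Section WordLengths.
Variable G : groupType.
Implicit Types (T : set G) (g h : G).

Lemma word_lengths1 T : word_lengths T 1%g 0.
Proof. by exists [::]; rewrite big_nil. Qed.

Lemma word_lengths_mem T g : T g -> word_lengths T g 1.
Proof.
move=> Tg; exists [:: g]; rewrite big_seq1; split=> // h.
by rewrite inE => /eqP->; exact/mem_set.
Qed.

Lemma word_lengthsM T g h i j :
  word_lengths T g i -> word_lengths T h j -> word_lengths T (g * h)%g (i + j)%N.
Proof.
move=> [s [<- sT ->]] [r [<- rT ->]]; exists (s ++ r).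
by rewrite size_cat big_cat; split=> // t; rewrite mem_cat => /orP[/sT|/rT].
Qed.

Lemma class_generatingV T g : class_generating T -> T g -> T g^-1%g.
Proof. by move=> [TV _ _] Tg; rewrite TV; exists g.
Qed.

Lemma class_generatingJ T g h : class_generating T -> T g -> T (g ^ h)%g.
Proof.
move=> [_ [s ->] _] [c cs [k _ <-]]; exists c => //.
by exists (k * h)%g => //; rewrite conjgM.
Qed.

End WordLengths.

(** An ultrafilter containing a singleton is principal, by maximality. So [w] contains the
    complement of every singleton, and finite intersections of these. *)
Lemma nonprincipal_ge (w : set_system nat) (Uw : UltraFilter w) :
  (forall n, w <> principal_filter n) ->
  forall m, w [set n | (m <= n)%N].
Proof.
move=> wP; have wC n : w (~` [set n])%classic.
  have [wn|//] := in_ultra_setVsetC [set n] Uw.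
  exfalso; apply: (wP n); apply/esym/max_filter; first exact: principal_filter_proper.
  move=> A wA; apply/principal_filterP.
  by have [k [Ak kn]] := filter_ex (filterI wA wn); rewrite -[n]kn.
elim=> [|m IH]; first by apply: filterS (filterT (F := w)).
apply: filterS (filterI IH (wC m)) => n [/= mn nm].
by rewrite ltn_neqAle mn andbT; apply/eqP => mE; apply: nm.
Qed.

(** * The norm on the cone and its comparison with word norms *)

Section ConeNorm.
Variables (R : realType) (w : set_system nat) (Uw : UltraFilter w).
Local Notation cone := (cone R Uw).
Local Notation cone_norm := (@cone_norm R w Uw).
Local Notation cls := (\pi_cone)%qT.
Implicit Types (a b : cone) (x y : adm_seq R).

Lemma cone_ind (P : cone -> Prop) : (forall x, P (cls x)) -> forall a, P a.
Proof. by move=> Px a; elim/(@quotW _ cone): a. Qed.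

Lemma cone_norm_ge0 a : 0 <= cone_norm a.
Proof.
apply: limr_ge; first exact: scaled_norm_cvg.
by apply: nearW => n; exact: scaled_norm_ge0.
Qed.

Lemma cone_normM a b : cone_norm (a * b)%g <= cone_norm a + cone_norm b.
Proof.
elim/cone_ind: a => x; elim/cone_ind: b => y; rewrite -cone_piM.
have cM := @cone_norm_cvg R w Uw (x * y)%g.
have cD : (scaled_norm R x \+ scaled_norm R y) @ w -->
    cone_norm (cls x) + cone_norm (cls y).
  by apply: cvgD; exact: cone_norm_cvg.
apply: ler_cvg_to cM cD _.
by apply: nearW => n; exact: scaled_normM.
Qed.

Lemma cone_piJ x y : cls (x ^ y)%g = (cls x ^ cls y)%g.
Proof. by rewrite !conjgE !cone_piM cone_piV. Qed.

Lemma cone_normJ a b : cone_norm (a ^ b)%g = cone_norm a.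
Proof.
elim/cone_ind: a => x; elim/cone_ind: b => y; rewrite -cone_piJ !cone_norm_pi.
rewrite (_ : scaled_norm R (x ^ y)%g = scaled_norm R x)//.
by apply/funext => n; rewrite /scaled_norm supp_normJ.
Qed.

Lemma cone_norm1 : cone_norm 1%g = 0.
Proof.
rewrite -[1%g]/(cls 1%g) cone_norm_pi.
rewrite (_ : scaled_norm R _ = cst 0).
  by apply: cvg_lim; [exact: Rhausdorff|exact: cvg_cst].
by apply/funext => n; rewrite /scaled_norm supp_norm1 mul0r.
Qed.

Lemma cone_norm_eq0 a : cone_norm a = 0 -> a = 1%g.
Proof.
elim/cone_ind: a => x x0; rewrite -[RHS]/(cls 1%g).
by apply/cone_eqP/cone_relP; rewrite invg1 mulg1 -x0; exact: cone_norm_cvg.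
Qed.

(** The norm is constant on each class, so the sum of its values at the class representatives is a
    bound. *)
Lemma class_generating_bounded (T : set cone) : class_generating T ->
  exists2 M, 0 <= M & forall t, T t -> cone_norm t <= M.
Proof.
move=> [_ [s ->] _]; exists (\sum_(c <- s) cone_norm c).
  by apply: sumr_ge0 => c _; exact: cone_norm_ge0.
move=> _ [c cs [h _ <-]]; rewrite cone_normJ /= in cs *.
by rewrite (big_rem c)//= lerDl sumr_ge0// => b _; exact: cone_norm_ge0.
Qed.

Lemma cone_norm_le_word_norm (T : set cone) (M : R) : class_generating T ->
  (forall t, T t -> cone_norm t <= M) ->
  forall g, cone_norm g <= M * (word_norm T g)%:R.
Proof.
move=> Tgen TM g; have [[s [<- sT ->]] _] := word_normP g Tgen.
elim: s sT => [|t s IH] sT; first by rewrite big_nil cone_norm1 mulr0.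
rewrite big_cons /= -natr1 mulrDr mulr1 addrC.
apply: le_trans (cone_normM _ _) _; apply: lerD.
  by apply/TM/set_mem/sT; rewrite mem_head.
by apply: IH => u us; apply: sT; rewrite inE us orbT.
Qed.

Lemma admissible_le (u : nat -> fsperm) x (C : nat) :
  (forall n, (supp_norm (u n) <= C * supp_norm (x n))%N) -> admissible R u.
Proof.
move=> ux; have [K xK] := admP x; exists (C%:R * K) => n n0.
apply: (@le_trans _ _ (C%:R * ((supp_norm (x n))%:R / n%:R))).
  by rewrite mulrA -natrM ler_wpM2r ?invr_ge0// ler_nat.
by rewrite ler_wpM2l// xK.
Qed.

Lemma admissible_tprod x (P : nat -> seq (nat * nat)) :
  (forall n, (size (P n) <= supp_norm (x n))%N) ->
  admissible R (fun n => tprod (P n)).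
Proof.
move=> sP; apply: (@admissible_le _ x 2) => n.
by apply: leq_trans (supp_norm_tprod _) _; rewrite leq_mul2l sP.
Qed.

Hypothesis w_nonprincipal : forall n, w <> principal_filter n.

(** A bounded error vanishes after division by [n], since [w] contains the set of [n > C / e]. This
    absorbs the leftover factor of [tprod_two_conj]. *)
Lemma cone_pi_eq_bounded (C : nat) x y :
  w [set n | (supp_norm (x n / y n)%g <= C)%N] -> cls x = cls y.
Proof.
move=> xyC; apply/cone_eqP/cone_relP/cvgr0Pnorm_lt => e e0.
have wn := nonprincipal_ge Uw w_nonprincipal (Num.truncn (C%:R / e)).+1.
apply: filterS (filterI xyC wn) => n [/= xyn Cn].
rewrite ger0_norm ?scaled_norm_ge0// /scaled_norm.
have n0 : 0 < n%:R :> R by rewrite ltr0n; exact: leq_trans Cn.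
rewrite ltr_pdivrMr//; apply: (@le_lt_trans _ _ C%:R); first by rewrite ler_nat.
rewrite mulrC -ltr_pdivrMr//; apply: lt_le_trans (truncnS_gt _) _.
by rewrite ler_nat.
Qed.

(** * Bounding the word norm by means of one generator of positive norm *)

Variables (T : set cone) (t : adm_seq R).
Hypotheses (Tgen : class_generating T) (Tt : T (cls t)).

Lemma word_lengths_small_tprod (p : adm_seq R) (P : nat -> seq (nat * nat)) :
    (forall n, p n = tprod (P n)) -> (forall n, uniq (flat (P n))) ->
    (forall n, (size (P n) <= 2 * (supp_norm (t n) %/ 6))%N) ->
  word_lengths T (cls p) 2.
Proof.
move=> pP uP sP.
have /choice[h /choice[k hk]] n := tprod_two_conj (uP n) (sP n).
have ah : admissible R h by apply: (@admissible_le _ t 4) => n; have [e []] := hk n.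
have ak : admissible R k by apply: (@admissible_le _ t 4) => n; have [e []] := hk n.
have -> : cls p = cls (t ^ AdmSeq ah * t^-1 ^ AdmSeq ak)%g.
  apply: (@cone_pi_eq_bounded 2); apply: filterS (filterT (F := w)) => n _ /=.
  have [e [_ _ en PE]] := hk n; rewrite pP PE.
  (* The quotient of [a e] by [a] is a conjugate of [e], hence moves at most two points. *)
  pose a := (t n ^ h n * (t n)^-1 ^ k n)%g.
  rewrite (_ : (_ / _)%g = (e ^ a^-1)%g) ?supp_normJ//.
  by rewrite -[LHS]/(a * e / a)%g [RHS]conjgE invgK mulgA.
rewrite cone_piM !cone_piJ cone_piV -[2%N]/(1 + 1)%N.
apply: word_lengthsM; apply: word_lengths_mem; apply: class_generatingJ => //.
exact: class_generatingV.
Qed.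

(** Each induction step cuts from every [P n] an initial block short enough for
    [word_lengths_small_tprod]. The bound by [y], valid for all [n], keeps both pieces admissible;
    that [N] blocks exhaust [P n] is known only on a set of [w]. *)
Lemma word_lengths_tprod N (y p : adm_seq R) (P : nat -> seq (nat * nat)) :
    (forall n, p n = tprod (P n)) -> (forall n, uniq (flat (P n))) ->
    (forall n, (size (P n) <= supp_norm (y n))%N) ->
    w [set n | (size (P n) <= N * (2 * (supp_norm (t n) %/ 6)))%N] ->
  word_lengths T (cls p) (2 * N)%N.
Proof.
elim: N p P => [|N IH] p P pP uP sP wP.
  suff -> : cls p = cls 1%g by exact: word_lengths1.
  apply: (@cone_pi_eq_bounded 0); apply: filterS wP => n /=.
  rewrite mul0n leqn0 size_eq0 => /eqP Pn.
  by rewrite pP Pn /tprod big_nil mulgV supp_norm1.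
pose q n := (2 * (supp_norm (t n) %/ 6))%N.
pose P1 n := take (q n) (P n); pose P2 n := drop (q n) (P n).
have PE n : P n = P1 n ++ P2 n by rewrite cat_take_drop.
have uP12 n : uniq (flat (P1 n)) /\ uniq (flat (P2 n)).
  by move: (uP n); rewrite PE flat_cat cat_uniq => /and3P[].
have sP12 n : (size (P1 n) <= supp_norm (y n))%N /\ (size (P2 n) <= supp_norm (y n))%N.
  by move: (sP n); rewrite PE size_cat; lia.
have a1 := admissible_tprod (fun n => (sP12 n).1).
have a2 := admissible_tprod (fun n => (sP12 n).2).
have -> : p = (AdmSeq a1 * AdmSeq a2)%g.
  by apply: adm_ext => n; rewrite pP PE tprod_cat.
rewrite cone_piM mulnS; apply: word_lengthsM.
  apply: (word_lengths_small_tprod (P := P1)) => // n; first by have [] := uP12 n.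
  by rewrite size_take; case: ltnP => // /ltnW.
apply: (IH _ P2) => //.
- by move=> n; have [] := uP12 n.
- by move=> n; have [] := sP12 n.
- by apply: filterS wP => n /=; rewrite size_drop -/(q n); lia.
Qed.

Lemma word_norm_le_cone_norm : 0 < cone_norm (cls t) ->
  forall g, (word_norm T g)%:R <=
    48 / cone_norm (cls t) * cone_norm g + (48 / cone_norm (cls t) + 4).
Proof.
set d := cone_norm (cls t) => d0; elim/cone_ind => y.
set r := cone_norm (cls y); have r0 : 0 <= r := cone_norm_ge0 _.
have /choice[P /choice[Q PQ]] n := two_involutions_tprod (y n).
(* For [w]-most [n], a block has at least [d n / 12] transpositions while [y n] moves fewer than
   [(r + 1) n] points, so [N] blocks suffice. *)
pose N := (Num.truncn (12 * (r + 1) / d)).+1.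
have N_gt : 12 * (r + 1) / d < N%:R := truncnS_gt _.
have N_le : N%:R <= 12 * (r + 1) / d + 1.
  by rewrite /N -[_.+1%:R]natr1 lerD2r truncn_le divr_ge0 ?(ltW d0)// mulr_ge0// addr_ge0.
have wN : w [set n | (supp_norm (y n) <= N * (2 * (supp_norm (t n) %/ 6)))%N].
  have wt : w [set n | d / 2 < scaled_norm R t n].
    by apply: cvgr_gt (@cone_norm_cvg R w Uw t) _ _; rewrite -/d; lra.
  have wy : w [set n | scaled_norm R y n < r + 1].
    by apply: cvgr_lt (@cone_norm_cvg R w Uw y) _ _; rewrite -/r; lra.
  (* Rounding in the division by 6 costs a block up to 2 transpositions out of [d n / 6]; once
     [d n > 24], at least [d n / 12] remain. *)
  have wn := nonprincipal_ge Uw w_nonprincipal (Num.truncn (24 / d)).+1.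
  apply: filterS (filterI (filterI wt wy) wn) => n [[/=]].
  rewrite /scaled_norm => tn yn dn.
  have n0 : 0 < n%:R :> R by rewrite ltr0n; exact: leq_trans dn.
  move: tn yn; rewrite ltr_pdivlMr// ltr_pdivrMr// => tn yn.
  have {}dn : 24 < d * n%:R.
    rewrite mulrC -ltr_pdivrMr//; apply: lt_le_trans (truncnS_gt _) _.
    by rewrite ler_nat.
  have tq : (supp_norm (t n))%:R <= 6 * (supp_norm (t n) %/ 6)%:R + 6 :> R.
    by rewrite -!natrM -natrD ler_nat; lia.
  rewrite -(ler_nat R) !natrM.
  move: N_gt; rewrite ltr_pdivrMr// => N_gt.
  set q := (_ %/ 6)%:R in tq *; set m := n%:R in n0 tn yn dn.
  have qd : d * m / 12 <= 2 * q by lra.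
  apply: (@le_trans _ _ (N%:R * (d * m / 12))); last by rewrite ler_wpM2l.
  by nra.
(* The word has length [4 * N]: two involutions, each of [N] blocks, each block two generators. *)
have bound4N N' : (N' <= 4 * N)%N -> N'%:R <= 48 / d * r + (48 / d + 4).
  rewrite -(ler_nat R) natrM => /le_trans; apply.
  have -> : 48 / d * r + (48 / d + 4) = 4 * (12 * (r + 1) / d + 1) by lra.
  by rewrite ler_pM2l.
apply: bound4N.
have sP n : (size (P n) <= supp_norm (y n))%N by have [] := PQ n.
have sQ n : (size (Q n) <= supp_norm (y n))%N by have [] := PQ n.
have -> : y = (AdmSeq (admissible_tprod sP) * AdmSeq (admissible_tprod sQ))%g.
  by apply: adm_ext => n; have [_ _ _ _ ->] := PQ n.
have [_] := word_normP (cls (AdmSeq (admissible_tprod sP) * AdmSeq (admissible_tprod sQ)))%g Tgen.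
apply; rewrite cone_piM (_ : 4 * N = 2 * N + 2 * N)%N; last by lia.
apply: word_lengthsM.
  apply: (word_lengths_tprod (y := y) (P := P)) => // [n|].
    by have [] := PQ n.
  by apply: filterS wN => n /=; exact: leq_trans.
apply: (word_lengths_tprod (y := y) (P := Q)) => // [n|].
  by have [] := PQ n.
by apply: filterS wN => n /=; exact: leq_trans.
Qed.

End ConeNorm.

(** * Coarse equivalence of the two norms *)

Theorem proposition5p10 (R : realType) (w : set_system nat)
    (Uw : UltraFilter w) (w_nonprincipal : forall n, w <> principal_filter n)
    (T : set (cone R Uw)) (T_gen : class_generating T) :
  coarsely_equivalent (@cone_norm R w Uw) (fun g => (word_norm T g)%:R).
Proof.
have [M M0 TM] := class_generating_bounded T_gen.
have lower := cone_norm_le_word_norm T_gen TM.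
suff [A [B [A0 B0 upper]]] : exists A B : R, [/\ 0 <= A, 0 <= B &
    forall g, (word_norm T g)%:R <= A * cone_norm g + B].
  (* A single constant has to dominate [M] in the lower estimate and [A] in the upper one; adding 1
     makes it positive. *)
  exists (M + A + 1), B; split=> // [|g]; first by lra.
  have N0 := cone_norm_ge0 g; have W0 : 0 <= (word_norm T g)%:R :> R by [].
  apply/andP; split.
    rewrite lerBlDr mulrC ler_pdivrMr; last by lra.
    by have := lower g; nra.
  by have := upper g; nra.
have [[t [Tt t0]]|noT] := pselect (exists t, T t /\ 0 < cone_norm t).
  have tE : cone_norm (\pi_(cone R Uw) (repr t))%qT = cone_norm t by rewrite reprK.
  exists (48 / cone_norm t), (48 / cone_norm t + 4); split.
  - by rewrite divr_ge0// ltW.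
  - by rewrite addr_ge0// divr_ge0// ltW.
  - by rewrite -tE; apply: word_norm_le_cone_norm; rewrite ?reprK.
(* If no generator has positive norm, every element has norm 0 and equals [1], so a constant bounds
   the word norm. *)
have T0 t : T t -> cone_norm t <= 0.
  by move=> Tt; rewrite leNgt; apply/negP => t0; apply: noT; exists t.
exists 0, (word_norm T 1%g)%:R; split=> // g; rewrite mul0r add0r.
suff -> : g = 1%g by [].
apply: cone_norm_eq0; apply/eqP; rewrite eq_le cone_norm_ge0 andbT.
by have := cone_norm_le_word_norm T_gen T0 g; rewrite mul0r.
Qed.
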